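(* Let $k\ge 2$ and let $A_k=\{a_1,\ldots,a_k\}\subset\mathbb{N}$ with $a_1<a_2<\cdots<a_k$. Let $\mathcal{C}_{A_k}$ be the set of complete words on $A_k$, $\mathcal{S}_{A_k}$ the set of superpatterns of length-$k$ preferential arrangements on $A_k$, and $\mathcal{R}_{A_k}$ the set of regular superpatterns of length-$k$ preferential arrangements on $A_k$. Then $\mathcal{C}_{A_k}=\mathcal{S}_{A_k}=\mathcal{R}_{A_k}$.
   Context: A preferential arrangement (p.a.) of length $k$ is a string of length $k$ of positive integers considered up to order isomorphism (two strings $x_1\cdots x_k$ and $y_1\cdots y_k$ are order isomorphic if for all $s,t$, $x_s<x_t \iff y_s<y_t$ and $x_s=x_t\iff y_s=y_t$); it is represented by its dense-ranking form, i.e. a string over $\{1,\ldots,m\}$ using every value in $\{1,\ldots,m\}$ for some $m$ (e.g. 112, 121, 123). A word on $A_k$ is a finite string with entries in $A_k$. An occurrence of a p.a. $\pi$ in a word $w$ is a subsequence (not necessarily contiguous) of $w$ that is order isomorphic to $\pi$. A superpattern of length-$k$ p.a.'s on $A_k$ is a word on $A_k$ containing an occurrence of every p.a. of length $k$ whose number of distinct values is at most $k$ (i.e. every length-$k$ p.a.). A complete word on $A_k$ is a word on $A_k$ containing every permutation of the elements of $A_k$ as a subsequence. A regular occurrence of a p.a. $\pi$ in a word on $A_k$ is an occurrence such that for each letter $c$ of $\pi$, if there are $i$ letters of $\pi$ (counted with multiplicity) strictly less than $c$ and $j$ copies of $c$ in $\pi$, then every position of $\pi$ carrying $c$ is represented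 in the word by an element of $\{a_{i+1},a_{i+2},\ldots,a_{i+j}\}$ (all copies of $c$ being represented by the same letter, as required by order isomorphism). For example over $[6]$, $113363$ and $225565$ are regular occurrences of $112232$, but $113343$ is not. A regular superpattern of length-$k$ p.a.'s on $A_k$ is a word on $A_k$ that contains a regular occurrence of every length-$k$ p.a. *)

(* Defs.v *)
From mathcomp Require Import all_boot.
From mathcomp Require Import classical_sets.

Set Implicit Arguments.
Unset Strict Implicit.
Unset Printing Implicit Defensive.

Local Open Scope classical_set_scope.

Definition order_isomorphic (x y : seq nat) : Prop :=
  size x = size y /\
  forall s t : nat, s < size x -> t < size x ->
    ((nth 0 x s < nth 0 x t) <-> (nth 0 y s < nth 0 y t)) /\
    ((nth 0 x s = nth 0 x t) <-> (nth 0 y s = nth 0 y t)).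

(* Order-isomorphism classes are represented by their dense-ranking form. *)
Definition pref_arrangement (k : nat) (pi : seq nat) : Prop :=
  size pi = k /\ exists m : nat, forall c : nat, (c \in pi) = (1 <= c <= m).

Definition occurrence (pi w u : seq nat) : Prop :=
  subseq u w /\ order_isomorphic u pi.

(* The alphabet A_k is given by its enumeration a, shifted by one since 'I_k
   starts at 0: a_(t+1) is a t. In particular {a_(i+1), ..., a_(i+j)} is
   {a t | i <= t < i + j}. *)
Definition word_on (k : nat) (a : 'I_k -> nat) (w : seq nat) : Prop :=
  {subset w <= codom a}.

Definition regular_occurrence (k : nat) (a : 'I_k -> nat)
    (pi w u : seq nat) : Prop :=
  occurrence pi w u /\
  forall s : nat, s < size pi ->
    let c := nth 0 pi s in
    let i := count (fun x => x < c) pi in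
    let j := count_mem c pi in
    exists t : 'I_k, i <= t < i + j /\ nth 0 u s = a t.

Definition complete_words (k : nat) (a : 'I_k -> nat) : set (seq nat) :=
  [set w | word_on a w /\
           forall p : seq nat, perm_eq p (codom a) -> subseq p w].

Definition superpatterns (k : nat) (a : 'I_k -> nat) : set (seq nat) :=
  [set w | word_on a w /\
           forall pi : seq nat, pref_arrangement k pi ->
             exists u : seq nat, occurrence pi w u].

Definition regular_superpatterns (k : nat) (a : 'I_k -> nat) : set (seq nat) :=
  [set w | word_on a w /\
           forall pi : seq nat, pref_arrangement k pi ->
             exists u : seq nat, regular_occurrence a pi w u].

(* Main.v *)
Require Import Defs.
From mathcomp Require Import all_boot all_order.
From mathcomp Require Import classical_sets.

Set Implicit Arguments.
Unset Strict Implicit.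
Unset Printing Implicit Defensive.

Import Order.TTheory.

Local Open Scope classical_set_scope.

(** The inclusions R ⊆ S and S ⊆ C are direct: a pattern with k distinct values
    has only one possible occurrence up to equality over k letters. For C ⊆ R,
    let w be complete and let B_c be the block of letters allowed to represent
    the value c of pi, so that |B_c| is the number of copies of c. Read pi from
    left to right and spell a permutation p of the alphabet: at a value c, take
    the unused letter of B_c whose next appearance in w is the latest. The letter
    b_c of B_c used last was available at all the earlier copies of c, hence it
    never comes later in w than the letter that was taken; so embedding p in w
    also embeds the word obtained by writing b_c for every copy of c. *)

(** * Greedy embedding and blocks of letters *)

Lemma subset_codom_map (I : finType) (T : eqType) (f : I -> T) (s : seq T) :
  {subset s <= codom f} -> exists q, s = map f q.
Proof.
elim: s => [|x s IHs] sub_s; first by exists [::].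
have [i ->] := codomP (sub_s x (mem_head x s)).
have [|q ->] := IHs; last by exists (i :: q).
by move=> y s_y; apply: sub_s; rewrite inE s_y orbT.
Qed.

(** Greedy matching: taking [x] at its first occurrence leaves the longest suffix of [w] for [s]. *)
Lemma subseq_cons_drop (T : eqType) (x : T) (s w : seq T) :
  subseq (x :: s) w = (x \in w) && subseq s (drop (index x w).+1 w).
Proof.
elim: w => //= y w IHw; rewrite inE eq_sym.
by case: eqVneq => _; rewrite ?drop0 //= IHw.
Qed.

(** The exchange step: an earlier first occurrence leaves at least as long a suffix. *)
Lemma subseq_cons_early (T : eqType) (x y : T) (s w : seq T) :
  index y w <= index x w -> x \in w ->
  subseq s (drop (index x w).+1 w) -> subseq (y :: s) w.
Proof.
move=> le_yx w_x sub_s; rewrite subseq_cons_drop.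
rewrite -index_mem (leq_ltn_trans le_yx) ?index_mem //=.
apply: subseq_trans sub_s _.
by rewrite -(subnK le_yx) -addnS -drop_drop drop_subseq.
Qed.

Lemma ex_arg_max_seq (T : eqType) (P : pred T) (F : T -> nat) (s : seq T) :
  has P s -> exists2 x, (x \in s) && P x & {in s, forall y, P y -> F y <= F x}.
Proof.
elim: s => //= z s IHs; have [Ps _|nPs] := boolP (has P s).
  have [x /andP[s_x Px] max_x] := IHs Ps.
  have [/andP[Pz lt_xz]|] := boolP (P z && (F x < F z)).
    exists z; first by rewrite mem_head.
    move=> y; rewrite inE => /predU1P[-> //|s_y Py].
    exact: leq_trans (max_x y s_y Py) (ltnW lt_xz).
  rewrite negb_and -leqNgt => nz; exists x; first by rewrite inE s_x orbT.
  move=> y; rewrite inE => /predU1P[-> Pz|]; last exact: max_x.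
  by move: nz; rewrite Pz.
rewrite orbF => Pz; exists z; first by rewrite mem_head.
move=> y; rewrite inE => /predU1P[-> //|s_y Py].
by case/hasP: nPs; exists y.
Qed.

(* Here [f] sends a letter to the value whose block contains it, and the blocks
   are the fibres of [f] on [L]. *)
Lemma latest_letter_spelling (T W V : eqType) (x0 : T) (a : T -> W) (f : T -> V)
    (pi : seq V) (w : seq W) (L : seq T) :
  perm_eq (map f L) pi ->
  exists p : seq T, exists b : V -> T,
    [/\ perm_eq p L,
        {in pi, forall c, b c \in L /\ f (b c) = c} &
        subseq (map a p) w -> subseq (map (a \o b) pi) w].
Proof.
elim: pi w L => [|c pi IHpi] w L perm_L.
  exists L, (fun=> x0); split=> //= _; exact: sub0seq.
have /ex_arg_max_seq: has (fun x => f x == c) L.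
  have: c \in map f L by rewrite (perm_mem perm_L) mem_head.
  by case/mapP=> x L_x ->; apply/hasP; exists x.
(* A letter absent from [w] has index [size w], so it counts as the latest; the embedding premise
   then fails. *)
case/(_ (fun x => index (a x) w)) => x /andP[L_x /eqP fx] max_x.
have perm_xL := perm_to_rem L_x.
have{} perm_L : perm_eq (map f (rem x L)) pi.
  rewrite -(perm_cons c) -(permPr perm_L) -fx -/(map f (x :: _)) perm_sym.
  exact: perm_map.
have [p [b [perm_p b_pi sub_b]]] :=
  IHpi (drop (index (a x) w).+1 w) _ perm_L.
(* If [c] recurs in [pi], its last letter is already given by [b]; otherwise [x] itself is the last
   one. *)
pose b' d := if d \in pi then b d else x.
have b'_pi : {in c :: pi, forall d, b' d \in L /\ f (b' d) = d}.
  move=> d; rewrite /b' inE; case: ifP => [pi_d _|_]; last first.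
    by rewrite orbF => /eqP->.
  by have [/mem_rem] := b_pi d pi_d.
exists (x :: p), b'; split=> //.
  by rewrite (permPr perm_xL) perm_cons.
rewrite /= subseq_cons_drop => /andP[w_x /sub_b sub_pi].
have [L_bc fbc] := b'_pi c (mem_head c pi).
(* [b' c] was still available in the block of [c], so by the choice of [x] it appears no later than
   [x]. *)
apply: subseq_cons_early (w_x) _; first by apply: max_x; rewrite ?fbc.
rewrite (_ : map _ pi = map (a \o b) pi) //.
by apply/eq_in_map => d pi_d; rewrite /= /b' pi_d.
Qed.

(** Equal entries of a sorted list are consecutive and preceded exactly by the smaller ones. This
    turns fibres of positions into the intervals that regularity allows. *)
Lemma sorted_nth_block (s : seq nat) (t : nat) :
  sorted leq s -> t < size s ->
  count (fun x => x < nth 0 s t) s <= t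
    < count (fun x => x < nth 0 s t) s + count_mem (nth 0 s t) s.
Proof.
move=> s_sorted lt_ts; set c := nth 0 s t.
have -> : count (fun x => x < c) s + count_mem c s = count (fun x => x <= c) s.
  rewrite -count_predUI -[RHS]addn0; congr (_ + _).
    by apply: eq_count => x /=; rewrite [RHS]leq_eqVlt orbC.
  apply/eqP; rewrite -leqn0 leqNgt -has_count; apply/hasPn => x _ /=.
  by case: ltngtP.
apply/andP; split; rewrite leqNgt; apply/negP => t_out.
  by have := nth_count_lt 0 s_sorted t_out; rewrite ltxx.
have /(nth_count_gt 0 s_sorted) : count (fun x => x <= c) s <= t < size s.
  by rewrite lt_ts andbT -ltnS.
by rewrite ltxx.
Qed.

(** * Order isomorphism of words *)

Lemma order_isomorphic_count_lt (x y : seq nat) (s : nat) :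
  order_isomorphic x y -> s < size x ->
  count (fun z => z < nth 0 x s) x = count (fun z => z < nth 0 y s) y.
Proof.
(* Both counts are rewritten over positions, where the isomorphism identifies the two predicates. *)
case=> sz_xy iso lt_s; rewrite -{2}(mkseq_nth 0 x) -{2}(mkseq_nth 0 y) !count_map.
rewrite -sz_xy; apply: eq_in_count => t; rewrite mem_iota /= => lt_t.
by have [lt_iff _] := iso t s lt_t lt_s; apply/idP/idP => /lt_iff.
Qed.

Lemma ltn_count_lt (s : seq nat) (c d : nat) :
  c \in s -> c < d -> count (fun z => z < c) s < count (fun z => z < d) s.
Proof.
move=> s_c lt_cd; rewrite !(permP (perm_to_rem s_c)) /= ltnn lt_cd add0n add1n ltnS.
by apply: sub_count => z /= lt_zc; apply: ltn_trans lt_cd.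
Qed.

(** Order isomorphism preserves the number of smaller entries, and within one multiset that number
    determines the entry. *)
Lemma order_isomorphic_perm_eq (x y : seq nat) :
  order_isomorphic x y -> perm_eq x y -> x = y.
Proof.
move=> iso perm_xy; apply: (@eq_from_nth _ 0) => [|s lt_s]; first by case: iso.
have [x_s y_s] : nth 0 x s \in x /\ nth 0 y s \in x.
  split; first exact: mem_nth.
  by rewrite (perm_mem perm_xy) mem_nth // -(perm_size perm_xy).
have := order_isomorphic_count_lt iso lt_s.
rewrite -(permP perm_xy).
by case: (ltngtP (nth 0 x s) (nth 0 y s)) => // lt_c eq_c;
  [have := ltn_count_lt x_s lt_c | have := ltn_count_lt y_s lt_c]; rewrite eq_c ltnn.
Qed.

Lemma order_isomorphic_uniq (x y : seq nat) :
  order_isomorphic x y -> uniq y -> uniq x.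
Proof.
case=> sz_xy iso /(uniqP 0) inj_y; apply/(uniqP 0) => s t lt_s lt_t.
have [_ [eq_xy _]] := iso s t lt_s lt_t.
by move=> /eq_xy; apply: inj_y; rewrite inE -sz_xy.
Qed.

Lemma order_isomorphic_map (T : eqType) (f g : T -> nat) (q : seq T) :
  (forall i j, (f i < f j) = (g i < g j)) ->
  order_isomorphic (map f q) (map g q).
Proof.
move=> fg; split=> [|s t]; rewrite !size_map // => lt_s lt_t.
have x0 : T by case: q lt_s {lt_t} => // x.
rewrite !(nth_map x0) // fg; split=> //.
have fg_le i j : (f i <= f j) = (g i <= g j) by rewrite leqNgt fg -leqNgt.
split=> eq_st; apply/eqP; rewrite eqn_leq.
  by rewrite -!fg_le eq_st leqnn.
by rewrite !fg_le eq_st leqnn.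
Qed.

Lemma order_isomorphic_trans (x y z : seq nat) :
  order_isomorphic x y -> order_isomorphic y z -> order_isomorphic x z.
Proof.
case=> sz_xy iso [sz_yz iso']; split=> [|s t lt_s lt_t]; first by rewrite sz_xy.
have [lt_iff eq_iff] := iso s t lt_s lt_t.
have [|| lt_iff' eq_iff'] := iso' s t; rewrite -?sz_xy //.
by split; apply: iff_trans; eassumption.
Qed.

(** * The three inclusions *)

Lemma alphabet_inj (k : nat) (a : 'I_k -> nat) :
  {mono a : i j / i < j} -> injective a.
Proof.
move=> ltn_a i j eq_a; apply: val_inj => /=.
by have := (ltn_a i j, ltn_a j i); rewrite eq_a ltnn; case=> + +; case: ltngtP.
Qed.

Lemma regular_superpatterns_sub (k : nat) (a : 'I_k -> nat) :
  regular_superpatterns a `<=` superpatterns a.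
Proof.
move=> w [w_a reg_w]; split=> // pi /reg_w[u [occ_u _]].
by exists u.
Qed.

Lemma superpatterns_sub_complete (k : nat) (a : 'I_k -> nat) :
  {mono a : i j / i < j} -> superpatterns a `<=` complete_words a.
Proof.
move=> ltn_a w [w_a sup_w]; split=> // p perm_p.
have a_uniq : uniq (codom a) by apply/injectiveP; apply: alphabet_inj ltn_a.
have [|q def_p] := @subset_codom_map _ _ a p.
  by move=> x; rewrite (perm_mem perm_p).
have sz_p : size p = k by rewrite (perm_size perm_p) size_codom card_ord.
(* The dense ranking of [p]: letter indices start at 0, ranks at 1. *)
pose pi := [seq (nat_of_ord t).+1 | t <- q].
have sz_pi : size pi = k by move: sz_p; rewrite def_p !size_map.
have pi_pa : pref_arrangement k pi.
  split=> //; exists k => c; apply/mapP/idP => [[t _ ->] //=|].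
  case: c => //= c lt_c; exists (Ordinal lt_c) => //.
  rewrite -(mem_map (alphabet_inj ltn_a)) -def_p (perm_mem perm_p).
  exact: codom_f.
have [u [sub_u iso_u]] := sup_w pi pi_pa.
have{iso_u} iso_up : order_isomorphic u p.
  apply: order_isomorphic_trans iso_u _; rewrite def_p.
  by apply: order_isomorphic_map => i j; rewrite ltn_a.
have u_uniq := order_isomorphic_uniq iso_up.
rewrite (perm_uniq perm_p) in u_uniq.
have sub_ua : {subset u <= codom a} by move=> x /(mem_subseq sub_u)/w_a.
(* [u] has [k] distinct letters from an alphabet of size [k], so it is a permutation of the
   alphabet. *)
rewrite -(order_isomorphic_perm_eq iso_up) //.
rewrite (permPr perm_p); apply: uniq_perm => //; first exact: u_uniq.
apply: (uniq_min_size (u_uniq a_uniq) sub_ua _).2.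
by case: iso_up => -> _; rewrite (perm_size perm_p).
Qed.

Lemma complete_sub_regular (k : nat) (a : 'I_k -> nat) :
  {mono a : i j / i < j} -> 0 < k -> complete_words a `<=` regular_superpatterns a.
Proof.
move=> ltn_a k_gt0 w [w_a compl_w]; split=> // pi [sz_pi _].
pose spi := sort leq pi.
have sz_spi : size spi = k by rewrite size_sort.
have spi_sorted : sorted leq spi by apply: sort_sorted; apply: leq_total.
(* Sorted [pi] is laid along the alphabet; the block of [c] is the fibre of [f] over [c]. *)
pose f (t : 'I_k) := nth 0 spi t.
have perm_f : perm_eq (map f (enum 'I_k)) pi.
  rewrite (_ : map f _ = spi) ?perm_sort //.
  rewrite -(mkseq_nth 0 spi) sz_spi /mkseq -val_enum_ord -map_comp.
  exact: eq_map.
have [p [b [perm_p b_pi sub_b]]] :=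
  @latest_letter_spelling _ _ _ (Ordinal k_gt0) a f pi w _ perm_f.
exists (map (a \o b) pi); split; last first.
  move=> s lt_s c i j; exists (b c); rewrite (nth_map 0) //; split=> //.
  have [_ fbc] := b_pi c (mem_nth 0 lt_s).
  rewrite /i /j -!(permP (permEl (perm_sort leq pi))) -/spi.
  move: (b c) fbc => t <-.
  by apply: sorted_nth_block; rewrite ?sz_spi.
split.
  apply/sub_b/compl_w; rewrite codomE; exact: perm_map.
split=> [|s t]; rewrite size_map // => lt_s lt_t; rewrite !(nth_map 0) //=.
(* Since [f] is nondecreasing, smaller values have blocks of smaller letters. *)
have lt_b c d : c \in pi -> d \in pi -> c < d -> a (b c) < a (b d).
  move=> /b_pi[_ fc] /b_pi[_ fd]; rewrite -{1}fc -{1}fd ltn_a !ltnNge.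
  apply: contra => le_bd; apply: (sorted_leq_nth leq_trans leqnn 0 spi_sorted) => //;
    by rewrite inE sz_spi.
have := lt_b _ _ (mem_nth 0 lt_s) (mem_nth 0 lt_t).
have := lt_b _ _ (mem_nth 0 lt_t) (mem_nth 0 lt_s).
case: (ltngtP (nth 0 pi s)) => [lt_c _ /(_ isT) lt_ab|lt_c /(_ isT) lt_ab _|-> _ _].
- by rewrite lt_ab; split=> //; split=> eq_c; move: lt_ab lt_c; rewrite eq_c ltnn.
- rewrite ltnNge (ltnW lt_ab); split=> //.
  by split=> eq_c; move: lt_ab lt_c; rewrite eq_c ltnn.
by rewrite ltnn.
Qed.

Theorem theorem1 (k : nat) (a : 'I_k -> nat) (hk : 2 <= k)
    (ha : forall i j : 'I_k, i < j -> a i < a j) :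
  complete_words a = superpatterns a /\
  superpatterns a = regular_superpatterns a.
Proof.
have ltn_a : {mono a : i j / i < j}.
  move=> i j; case: (ltngtP i j) => [/ha //|/ha lt_ji|/val_inj->].
    by rewrite ltnNge (ltnW lt_ji).
  exact: ltnn.
have CR := complete_sub_regular ltn_a (ltnW hk).
have SC := superpatterns_sub_complete ltn_a.
have RS := @regular_superpatterns_sub k a.
by split; apply/seteqP; split=> w; [move/CR/RS | move/SC | move/SC/CR | move/RS].
Qed.
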